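(* Let $L$ be a complete lattice, $\mathrm{V}$ a join-dense set of elements of $L$, and $\vartriangleleft$ a binary relation on $\mathrm{V}$ that is suitable for $L$ (so that $L$ is isomorphic to $\mathfrak{L}(\mathrm{V},\vartriangleleft)$ via $b\mapsto\varphi(b)=\{x\in\mathrm{V}\mid x\leq b\}$). Given a completely multiplicative operation $\Box$ on $L$, define a binary relation $R$ on $\mathrm{V}$ by $xRy$ iff $y\leq\bigwedge\{a\in L\mid x\leq\Box a\}$. Then $(\mathrm{V},\vartriangleleft,R)$ is a CA frame, and $\varphi$ is an isomorphism from $(L,\Box)$ to $(\mathfrak{L}(\mathrm{V},\vartriangleleft),\Box_R)$.
   Context: A compatibility frame is a pair $(X,\vartriangleleft)$ with $X$ a nonempty set and $\vartriangleleft$ a reflexive binary relation on $X$. Write $y\vartriangleright x$ for $x\vartriangleleft y$, and for $A\subseteq X$ let $c_\vartriangleleft(A)=\{x\in X\mid \forall x'\vartriangleleft x\ \exists x''\vartriangleright x':\ x''\in A\}$. This is a closure operator on $\wp(X)$. A $c_\vartriangleleft$-fixpoint is an $A\subseteq X$ with $c_\vartriangleleft(A)=A$. $\mathfrak{L}(X,\vartriangleleft)$ is the complete lattice of $c_\vartriangleleft$-fixpoints ordered by $\subseteq$ (meets are intersections; $\bigvee A_i=c_\vartriangleleft(\bigcup A_i)$). $\mathrm{V}\subseteq L$ is join-dense if every element of $L$ is the join of some subset of $\mathrm{V}$. A binary relation $\vartriangleleft$ on $\mathrm{V}$ is suitable for $L$ if it is reflexive and: (1) for $a\in\mathrm{V}$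 and $b\in L$, if $a\not\leq b$, then $\exists a'\vartriangleleft a\ \forall a''\vartriangleright a'$: $a''\not\leq b$ (with $a',a''\in\mathrm{V}$); (2) if $a\in\mathrm{V}$, $B$ is a $c_\vartriangleleft$-fixpoint of $(\mathrm{V},\vartriangleleft)$ with a join $b$ in $L$, and $a\leq b$, then $a\in B$. A unary operation $\Box$ on $L$ is completely multiplicative if for any $A\subseteq L$ such that $\bigwedge A$ exists in $L$, $\Box\bigwedge A=\bigwedge\{\Box a\mid a\in A\}$. A compatibility and accessibility (CA) frame is a triple $(X,\vartriangleleft,R)$ where $(X,\vartriangleleft)$ is a compatibility frame and $R$ is a binary relation on $X$ such that for every $c_\vartriangleleft$-fixpoint $A\subseteq X$, the set $\Box_R A=\{x\in X\mid R(x)\subseteq A\}$ is also a $c_\vartriangleleft$-fixpoint, where $R(x)=\{y\in X\mid xRy\}$. *)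

(* Defs.v *)
From mathcomp Require Import all_boot all_order.
From mathcomp Require Import boolp classical_sets functions.

Set Implicit Arguments.
Unset Strict Implicit.
Unset Printing Implicit Defensive.

Import Order.TTheory.
Local Open Scope classical_set_scope.
Local Open Scope order_scope.

(* Joins and meets in a poset are expressed by membership in [supremums A] and
   [infimums A] (the least upper / greatest lower bounds of A).  The functions
   [supremum x0 A] and [infimum x0 A] are avoided because they return the
   default x0 when A is empty, which is not the join / meet of the empty set. *)

Section frames.
Context {X : Type}.
Implicit Types (lhd R : X -> X -> Prop) (A : set X).

Definition compatibility_frame lhd : Prop :=
  inhabited X /\ forall x, lhd x x.

Definition closure_op lhd A : set X :=
  [set x | forall x', lhd x' x -> exists2 x'', lhd x' x'' & A x''].

Definition fixpoints lhd : set (set X) := [set A | closure_op lhd A = A].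

Definition box_rel R A : set X := [set x | [set y | R x y] `<=` A].

Definition CA_frame lhd R : Prop :=
  compatibility_frame lhd /\
  forall A, fixpoints lhd A -> fixpoints lhd (box_rel R A).

End frames.

Section complete_lattices.
Context {d : Order.disp_t} {L : porderType d}.
Implicit Types (V : set L) (Box : L -> L).

Definition complete_lattice_axiom : Prop :=
  forall A : set L, supremums A !=set0 /\ infimums A !=set0.

Definition join_dense V : Prop :=
  forall b : L, exists2 A : set L, A `<=` V & supremums A b.

Definition suitable V (lhd : V -> V -> Prop) : Prop :=
  [/\ forall a : V, lhd a a,
      forall (a : V) (b : L), ~ (val a <= b) ->
        exists2 a' : V, lhd a' a &
          forall a'' : V, lhd a' a'' -> ~ (val a'' <= b)
    & forall (a : V) (B : set V) (b : L), fixpoints lhd B ->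
        supremums [set val v | v in B] b -> val a <= b -> B a].

Definition completely_multiplicative Box : Prop :=
  forall (A : set L) (m : L),
    infimums A m -> infimums [set Box a | a in A] (Box m).

Definition down_map V (b : L) : set V := [set x : V | val x <= b].

Definition accessibility V Box (x y : V) : Prop :=
  exists2 m : L, infimums [set a | val x <= Box a] m & val y <= m.

(* [f] is an isomorphism from (L, Box) onto the complete lattice of
   fixpoints of [closure_op lhd] (ordered by inclusion, with meets given by
   intersections and joins by closures of unions) with the operation [box_rel R].
   The empty meet is the whole of X, and the empty join is the closure of set0. *)
Definition fixpoint_isomorphism (X : Type) (lhd R : X -> X -> Prop) Box
    (f : L -> set X) : Prop :=
  [/\ set_bij [set: L] (fixpoints lhd) f,
      forall a b : L, a <= b <-> f a `<=` f b,
      forall (A : set L) (m : L),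
        infimums A m -> f m = \bigcap_(a in A) f a,
      forall (A : set L) (j : L),
        supremums A j -> f j = closure_op lhd (\bigcup_(a in A) f a)
    & forall a : L, f (Box a) = box_rel R (f a)].

End complete_lattices.

Arguments complete_lattice_axiom {d} L.
Arguments down_map {d L} V b.

(* Main.v *)
Require Import Defs.
From mathcomp Require Import all_boot all_order.
From mathcomp Require Import boolp classical_sets functions.

(** The relation [lhd] recovers [L] because the closed sets of V are exactly the
    principal down-sets [down_map V b]: the first suitability condition makes
    each of them closed ([down_map_fixpoint]), and the second makes each closed
    set equal to the down-set of its join ([fixpoint_down_map]).  Density of V
    makes the map [down_map V] an order embedding, so meets go to intersections;
    a join goes to the closure of the union because that closure is itself the
    down-set of some element.

    For the modality, let m be the meet of all a such that x <= Box a.  Complete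
    multiplicativity gives x <= Box m, so m is the least element of that set and,
    Box being monotone, x <= Box a holds exactly when m <= a.  As the
    R-successors of x are the elements of V below m, density makes m <= a
    equivalent to all successors of x lying below a.  This is
    [down_map_box]: box_rel R corresponds to Box under [down_map V].  Since every
    closed set is a down-set, box_rel R preserves closed sets, which is the
    condition for a CA frame. *)

Set Implicit Arguments.
Unset Strict Implicit.
Unset Printing Implicit Defensive.

Import Order.TTheory.
Local Open Scope classical_set_scope.
Local Open Scope order_scope.

Section closure.
Context {X : Type} (lhd : X -> X -> Prop).

Lemma closure_op_increasing (A : set X) : A `<=` closure_op lhd A.
Proof. by move=> x Ax x' x'x; exists x. Qed.

Lemma closure_opS (A B : set X) :
  A `<=` B -> closure_op lhd A `<=` closure_op lhd B.
Proof.
by move=> AB x Ax x' /Ax[x'' x'x'' Ax'']; exists x'' => //; exact: AB.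
Qed.

Lemma closure_op_fixpoint (A : set X) : fixpoints lhd (closure_op lhd A).
Proof.
rewrite /fixpoints /=; apply/seteqP; split; last exact: closure_op_increasing.
by move=> x ccAx x' /ccAx[x'' x'x'' cAx'']; exact: cAx''.
Qed.

End closure.

Lemma completely_multiplicative_homo (d : Order.disp_t) (L : porderType d)
    (Box : L -> L) :
  completely_multiplicative Box -> {homo Box : a b / a <= b}.
Proof.
move=> Box_mult a b ab.
(* The meet of [set a; b] is a, so Box a is a lower bound of its image. *)
have inf_ab : infimums [set a; b] a.
  by split=> [c [->|->]//|c lb_c]; apply: lb_c; left.
by have [lb _] := Box_mult _ _ inf_ab; apply: lb; exists b => //; right.
Qed.

Section representation.
Context {d : Order.disp_t} {L : porderType d}.
Context (V : set L) (lhd : V -> V -> Prop).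

Lemma down_map_sub (a b : L) :
  join_dense V -> (down_map V a `<=` down_map V b) <-> a <= b.
Proof.
move=> V_dense; split=> [sub_ab|ab x xa]; last exact: le_trans xa ab.
have [A AV [ubA lubA]] := V_dense a.
apply: lubA => v Av.
have Vv : v \in V by rewrite inE; exact: AV.
exact: (sub_ab (SigSub Vv) (ubA _ Av)).
Qed.

Lemma down_map_infimum (A : set L) (m : L) :
  infimums A m -> down_map V m = \bigcap_(a in A) down_map V a.
Proof.
move=> [lb glb]; apply/seteqP; split=> [x xm a Aa|x lb_x].
  exact: le_trans xm (lb _ Aa).
by apply: glb => a Aa; exact: lb_x.
Qed.

(** An element x of the closure that is not below b would have some x' related
    to it such that no x'' with lhd x' x'' is below b; membership in the closure
    provides one. *)
Lemma down_map_fixpoint (b : L) : suitable lhd -> fixpoints lhd (down_map V b).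
Proof.
move=> [_ separates _]; rewrite /fixpoints /=.
apply/seteqP; split; last exact: closure_op_increasing.
move=> x cx; apply: contrapT => /separates[x' x'x not_below].
by have [x'' x'x'' x''b] := cx _ x'x; exact: not_below x''b.
Qed.

Lemma fixpoint_down_map (B : set V) (b : L) :
  suitable lhd -> fixpoints lhd B -> supremums [set val v | v in B] b ->
  B = down_map V b.
Proof.
move=> [_ _ below_join] B_fix sup_b; apply/seteqP; split=> [x Bx|x xb].
  by apply: sup_b.1; exists x.
exact: below_join sup_b xb.
Qed.

Lemma fixpoint_is_down_map (B : set V) :
  complete_lattice_axiom L -> suitable lhd -> fixpoints lhd B ->
  exists b, B = down_map V b.
Proof.
move=> L_complete suit B_fix.
have [[b sup_b] _] := L_complete [set val v | v in B].
by exists b; exact: fixpoint_down_map.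
Qed.

(** The closure of the union is the down-set of some b; this b bounds A, hence
    its join j.  The converse inclusion holds as the down-set of j is closed. *)
Lemma down_map_supremum (A : set L) (j : L) :
  complete_lattice_axiom L -> join_dense V -> suitable lhd ->
  supremums A j -> down_map V j = closure_op lhd (\bigcup_(a in A) down_map V a).
Proof.
move=> L_complete V_dense suit [ub_j lub_j].
apply/seteqP; split; last first.
  rewrite -[X in _ `<=` X](down_map_fixpoint j suit); apply: closure_opS.
  by move=> x [a Aa xa]; exact: le_trans xa (ub_j _ Aa).
set U := \bigcup_(a in A) _.
have [b cUb] := fixpoint_is_down_map L_complete suit (closure_op_fixpoint lhd U).
rewrite cUb; apply/(down_map_sub _ _ V_dense); apply: lub_j => a Aa.
apply/(down_map_sub _ _ V_dense); rewrite -cUb => x xa.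
by apply: closure_op_increasing; exists a.
Qed.

(** The meet m of all a with x <= Box a satisfies x <= Box m, as x is a lower
    bound of the elements Box a and Box m is their meet. *)
Lemma down_map_box (Box : L -> L) (a : L) :
  complete_lattice_axiom L -> join_dense V -> completely_multiplicative Box ->
  down_map V (Box a) = box_rel (@accessibility d L V Box) (down_map V a).
Proof.
move=> L_complete V_dense Box_mult; apply/seteqP; split=> x.
  by move=> xa y [m [lb_m _] ym]; apply: le_trans ym _; exact: lb_m.
move=> succ_x.
have [_ [m inf_m]] := L_complete [set c | val x <= Box c].
have xm : val x <= Box m.
  by have [_] := Box_mult _ _ inf_m; apply=> _ [c xc <-].
apply: le_trans xm (completely_multiplicative_homo Box_mult _).
by apply/(down_map_sub _ _ V_dense) => y ym; apply: succ_x; exists m.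
Qed.

End representation.

Theorem proposition4p6 (d : Order.disp_t) (L : porderType d)
    (L_complete : complete_lattice_axiom L)
    (V : set L) (V_nonempty : V !=set0) (V_dense : join_dense V)
    (lhd : V -> V -> Prop) (lhd_suitable : suitable lhd)
    (Box : L -> L) (Box_mult : completely_multiplicative Box) :
  CA_frame lhd (@accessibility d L V Box) /\
  fixpoint_isomorphism lhd (@accessibility d L V Box) Box (down_map V).
Proof.
have box_eq a := down_map_box a L_complete V_dense Box_mult.
split; split.
- split; last by case: lhd_suitable.
  by case: V_nonempty => v /mem_set Vv; exact: inhabits (SigSub Vv).
- move=> A /(fixpoint_is_down_map L_complete lhd_suitable)[b ->].
  by rewrite -box_eq; exact: down_map_fixpoint.
- split=> [b _|a b _ _ eq_ab|B].
  + exact: down_map_fixpoint.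
  + by apply/eqP; rewrite eq_le; apply/andP; split;
      apply/(down_map_sub _ _ V_dense); rewrite eq_ab.
  + by move=> /(fixpoint_is_down_map L_complete lhd_suitable)[b ->]; exists b.
- by move=> a b; split => /(down_map_sub _ _ V_dense).
- exact: down_map_infimum.
- by move=> A j; exact: down_map_supremum.
- exact: box_eq.
Qed.
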